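(* Let $N\ge1$, $d\ge2$, let $\bm{p}=(p_1,\ldots,p_d)$ be a probability distribution with all $p_j>0$, and let $\bm{u}=\{u^{(l)}\}_{l=0}^{d-1}$ be real functions on $\{1,\ldots,d\}$ with $u^{(0)}\equiv1$ and $\sum_{i=1}^d u^{(l)}_iu^{(m)}_ip_i=a_l\delta_{lm}$, $a_l>0$, for $l,m=0,\ldots,d-1$. Put $\omega_i^{(j)}=u_{j+1}^{(i-1)}$ for $j=0,\ldots,d-1$, $i=1,\ldots,d$, suppose $\omega_i^{(0)}\neq0$ for all $i=1,\ldots,d$, and let $\widehat\omega_i^{(j)}=\omega_i^{(j)}/\omega_i^{(0)}$. Let $\bm{b}=(b_1,\ldots,b_d)$ be the probability distribution proportional to $\big(a_{l-1}^{-1}(\omega_l^{(0)})^2\big)_{l=1}^d$. Then for all $\bm{x}=(x_1,\ldots,x_d)\in\mathbb{Z}_{\ge0}^d$ with $|\bm{x}|=N$ and all $\bm{n}=(n_1,\ldots,n_{d-1})\in\mathbb{Z}_{\ge0}^{d-1}$ with $|\bm{n}|\le N$, $$\binom{N}{\bm{n}^+}^{-1}\binom{N}{\bm{x}}Q_{\bm{n}}(\bm{x};\bm{u})=\prod_{i=1}^d\big(\omega_i^{(0)}\big)^{n_{i-1}}\;Q^*_{\bm{x}^-}(\bm{n}^+;\widehat{\bm{\omega}}),$$ where $\bm{x}^-=(x_2,\ldots,x_d)$ and $Q^*_{\bm{x}^-}(\bm{n}^+;\widehat{\bm{\omega}})$, $\sum_{j=2}^d x_j\le N$, are the multivariate Krawtchouk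 polynomials in the variable $\bm{n}^+$ with basis functions $\widehat{\bm{\omega}}=\{\widehat\omega^{(j)}\}_{j=0}^{d-1}$, orthogonal on the multinomial distribution $m(\bm{n}^+;\bm{b})$.
   Context: For a vector, $|\cdot|$ denotes the sum of entries. $\bm{n}^+=(n_0,n_1,\ldots,n_{d-1})$ with $n_0=N-\sum_{j=1}^{d-1}n_j$. $\binom{N}{\bm{x}}=N!/\prod_j x_j!$ and $\binom{N}{\bm{n}^+}=N!/\prod_{j=0}^{d-1}n_j!$. The multinomial distribution is $m(\bm{x};\bm{p})=\binom{N}{\bm{x}}\prod_{j=1}^dp_j^{x_j}$, $|\bm{x}|=N$. The multivariate Krawtchouk polynomial $Q_{\bm{n}}(\bm{x};\bm{u})$ is the coefficient of $w_1^{n_1}\cdots w_{d-1}^{n_{d-1}}$ in $$\prod_{j=1}^d\Big(1+\sum_{l=1}^{d-1}w_lu_j^{(l)}\Big)^{x_j}.$$ Correspondingly, $Q^*_{\bm{x}^-}(\bm{n}^+;\widehat{\bm{\omega}})$ is the coefficient of $w_1^{x_2}w_2^{x_3}\cdots w_{d-1}^{x_d}$ in $\prod_{i=1}^d\big(1+\sum_{j=1}^{d-1}w_j\widehat\omega_i^{(j)}\big)^{n_{i-1}}$. Orthogonality on $m(\cdot;\bm{b})$ means that for $\bm{x}^-\ne\bm{y}^-$, $\sum_{\bm{n}^+:|\bm{n}^+|=N}Q^*_{\bm{x}^-}(\bm{n}^+;\widehat{\bm{\omega}})Q^*_{\bm{y}^-}(\bm{n}^+;\widehat{\bm{\omega}})\,m(\bm{n}^+;\bm{b})=0$,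 where $m(\bm{n}^+;\bm{b})=\binom{N}{\bm{n}^+}\prod_{i=1}^db_i^{n_{i-1}}$. *)

(* Defs.v *)
From HB Require Import structures.
From mathcomp Require Import all_boot all_order all_algebra.
From mathcomp Require Import reals.
From mathcomp Require Import mpoly.

Set Implicit Arguments.
Unset Strict Implicit.
Unset Printing Implicit Defensive.

Import Order.TTheory GRing.Theory Num.Theory.

Local Open Scope ring_scope.

(* Conventions.  We write d = k.+1; the points 1, ..., d and the labels
   0, ..., d-1 are both represented by 'I_k.+1, so u l j stands for
   u^(l)_(j+1).  The label l+1 (resp. the point l+2) is lift ord0 l, for
   l : 'I_k, and the variable w_(l+1) is 'X_l. *)

Definition distribution (R : realType) (m : nat) (p : 'I_m -> R) : Prop :=
  (forall j, 0 <= p j) /\ \sum_(j < m) p j = 1.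

Definition orthogonal_basis (R : realType) (k : nat) (p : 'I_k.+1 -> R)
    (u : 'I_k.+1 -> 'I_k.+1 -> R) (a : 'I_k.+1 -> R) : Prop :=
  [/\ forall j, u ord0 j = 1,
      forall l, 0 < a l
    & forall l m, \sum_(i < k.+1) u l i * u m i * p i = a l *+ (l == m)].

Definition multinomial_coef (R : realType) (N m : nat) (x : 'X_{1..m}) : R :=
  N`!%:R / \prod_(j < m) (x j)`!%:R.

Definition multinomial_pmf (R : realType) (N m : nat) (x : 'X_{1..m})
    (p : 'I_m -> R) : R :=
  multinomial_coef R N x * \prod_(j < m) p j ^+ x j.

(* Both Q_n(x; u) and Q*_(x^-)(n^+; omega-hat) are instances. *)
Definition krawtchouk (R : realType) (k : nat) (n : 'X_{1..k})
    (x : 'X_{1..k.+1}) (u : 'I_k.+1 -> 'I_k.+1 -> R) : R :=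
  (\prod_(j < k.+1)
     (1 + \sum_(l < k) u (lift ord0 l) j *: 'X_l : {mpoly R[k]}) ^+ x j)@_n.

(* n^+ = (N - |n|, n_1, ..., n_(d-1)); the subtraction is only meaningful
   for |n| <= N. *)
Definition mplus (N k : nat) (n : 'X_{1..k}) : 'X_{1..k.+1} :=
  [multinom if unlift ord0 i is Some j then n j else (N - mdeg n)%N
  | i < k.+1].

Definition mminus (k : nat) (x : 'X_{1..k.+1}) : 'X_{1..k} :=
  [multinom x (lift ord0 j) | j < k].

(* omega^(j)_i = u^(i-1)_(j+1): with 0-based indices, a transposition. *)
Definition omega (R : realType) (k : nat) (u : 'I_k.+1 -> 'I_k.+1 -> R)
    (j i : 'I_k.+1) : R := u i j.

Definition omega_hat (R : realType) (k : nat) (u : 'I_k.+1 -> 'I_k.+1 -> R)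
    (j i : 'I_k.+1) : R := omega u j i / omega u ord0 i.

Definition proportional_dist (R : realType) (m : nat) (w : 'I_m -> R)
    (l : 'I_m) : R := w l / \sum_(i < m) w i.

Definition dual_dist (R : realType) (k : nat) (u : 'I_k.+1 -> 'I_k.+1 -> R)
    (a : 'I_k.+1 -> R) : 'I_k.+1 -> R :=
  proportional_dist (fun l => (a l)^-1 * omega u ord0 l ^+ 2).

(* The sum ranges over all n^+ with |n^+| = N, as bounded multi-indices. *)
Definition krawtchouk_orthogonal (R : realType) (N k : nat)
    (b : 'I_k.+1 -> R) (v : 'I_k.+1 -> 'I_k.+1 -> R) : Prop :=
  forall x y : 'X_{1..k}, (mdeg x <= N)%N -> (mdeg y <= N)%N -> x <> y ->
    \sum_(n : 'X_{1..k.+1 < N.+1} | mdeg n == N)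
      krawtchouk x n v * krawtchouk y n v * multinomial_pmf N n b = 0.

(* Main.v *)
Require Import Defs.
From HB Require Import structures.
From mathcomp Require Import all_boot all_order all_algebra.
From mathcomp Require Import reals.
From mathcomp Require Import mpoly.
From mathcomp Require Import ring.

(* For a matrix M, let M^(x) be the product over j of (sum_l M_lj X_l)^(x_j).
   Homogenising with X_0, Q_n(x; u) is the coefficient of X^(n^+) in u^(x), and
   Q*_(x^-)(n^+; omega-hat) that of X^x in omega-hat^(n^+).  Up to factorials,
   M^(x) is the x-th column of a symmetric power of M; hence
   - transposition: n! [X^n] M^(x) = x! [X^x] (M^T)^(n), which is the duality;
   - multiplicativity: (AB)^(x) = sum_n [X^n] B^(x) . A^(n), so the sum in the
     orthogonality relation is a coefficient of (V diag(b) V^T)^(y) with V the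
     matrix of omega-hat.
   The matrix V diag(b) V^T is diagonal because u diag(p) u^T = diag(a) can be
   inverted to u^T diag(a)^-1 u = diag(p)^-1. *)

Set Implicit Arguments.
Unset Strict Implicit.
Unset Printing Implicit Defensive.

Import Order.TTheory GRing.Theory Num.Theory.

Local Open Scope ring_scope.

(** Induction on the degree, one unit at a time; this matches the Leibniz rule and products by a
    single variable. *)
Lemma mnm_ind n (P : 'X_{1..n} -> Prop) :
  P 0%MM -> (forall m i, P m -> P (m + U_(i))%MM) -> forall m, P m.
Proof.
move=> P0 PS m; move: {2}(mdeg m) (erefl (mdeg m)) => d.
elim: d m => [|d IH] m md; first by move/eqP: md; rewrite mdeg_eq0 => /eqP ->.
have [i mi] : exists i, m i != 0%N.
  apply/existsP; rewrite -[[exists _, _]]negbK negb_exists.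
  apply/negP => /forallP m0; move: md; rewrite mdegE big1 // => i _.
  by apply/eqP; have := m0 i; rewrite negbK.
have im : (U_(i) <= m)%MM by rewrite lep1mP.
rewrite -(submK im); apply/PS/IH.
by have := md; rewrite -{1}(submK im) mdegD mdeg1 addn1 => -[].
Qed.

Lemma submUDC n (m : 'X_{1..n}) i j : (0 < m j)%N ->
  (m - U_(j) + U_(i) = m + U_(i) - U_(j))%MM.
Proof.
move=> mj; apply/mnmP => l; rewrite !mnmDE !mnmBE mnmDE !mnm1E.
by rewrite addnBAC //; case: eqP => // <-.
Qed.

Lemma mcoeff_mulXU_eq0 (R : nzRingType) n (p : {mpoly R[n]}) (i : 'I_n)
    (m : 'X_{1..n}) :
  m i = 0%N -> (p * 'X_i)@_m = 0.
Proof.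
move=> mi; rewrite mcoeffM big1 // => -[k1 k2] /= /eqP mk; rewrite mcoeffX.
case: eqP => [k2E|]; last by rewrite mulr0.
by move/mnmP/(_ i): mk; rewrite mi -k2E mnmDE mnm1E eqxx addn1.
Qed.

(** * Products of powers of linear forms attached to a matrix *)

Section LinearForms.
Variables (R : comNzRingType).

(** The M^(x) of the overview: the image of X^x under the algebra morphism sending X_j to the linear
    form of column j. *)
Definition lmonom m n (M : 'M[R]_(m, n)) (x : 'X_{1..n}) : {mpoly R[m]} :=
  \prod_(j < n) (\sum_(l < m) M l j *: 'X_l) ^+ x j.

Lemma lmonom0 m n (M : 'M[R]_(m, n)) : lmonom M 0%MM = 1.
Proof. by apply: big1 => j _; rewrite mnmE expr0. Qed.

Lemma lmonomD m n (M : 'M[R]_(m, n)) x y :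
  lmonom M (x + y)%MM = lmonom M x * lmonom M y.
Proof. by rewrite -big_split; apply: eq_bigr => j _; rewrite mnmDE exprD. Qed.

Lemma lmonomU m n (M : 'M[R]_(m, n)) j :
  lmonom M U_(j)%MM = \sum_(l < m) M l j *: 'X_l.
Proof.
rewrite /lmonom (bigD1 j) //= mnm1E eqxx expr1.
rewrite [X in _ * X]big1 ?mulr1 // => i ij.
by rewrite mnm1E eq_sym (negPf ij).
Qed.

Lemma dhomog_lmonom m n (M : 'M[R]_(m, n)) x :
  lmonom M x \is (mdeg x).-homog.
Proof.
elim/mnm_ind: x => [|x j IH]; first by rewrite lmonom0 mdeg0 dhomog1.
rewrite lmonomD mdegD mdeg1 dhomogM // lmonomU rpred_sum // => l _.
by rewrite rpredZ // dhomogX; apply/eqP/mdeg1.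
Qed.

Lemma mderiv_lmonom m n (M : 'M[R]_(m, n)) x l :
  (lmonom M x)^`M(l) = \sum_(j < n) (M l j *: lmonom M (x - U_(j))%MM) *+ x j.
Proof.
elim/mnm_ind: x => [|x i IH].
  rewrite lmonom0 -mpolyC1 mderivC big1 // => j _.
  by rewrite mnmE mulr0n.
rewrite lmonomD mderivM IH.
have Ull : (U_(l) - U_(l) = 0 :> 'X_{1..m})%MM.
  by rewrite -{1}[U_(l)%MM]add0m addmK.
have -> : (lmonom M U_(i)%MM)^`M(l) = (M l i)%:MP.
  rewrite lmonomU raddf_sum (bigD1 l) //= big1 => [|k kl].
    by rewrite mderivZ mderivX mnm1E eqxx Ull mpolyX0 scale1r addr0 alg_mpolyC.
  by rewrite mderivZ mderivX mnm1E (negPf kl) scale0r scaler0.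
under [RHS]eq_bigr do rewrite mnmDE mulrnDr.
rewrite big_split /= mulr_suml; congr (_ + _).
  apply: eq_bigr => j _; rewrite mulrnAl -scalerAl -lmonomD.
  (* For [x j = 0] the truncated [x - U_(j)] is meaningless, but the multiplicity [x j] kills the
     term. *)
  have [->|xj] := posnP (x j); first by rewrite !mulr0n.
  by rewrite submUDC.
rewrite (bigD1 i) //= mnm1E eqxx mulr1n addmK big1 => [|j ji].
  by rewrite addr0 mulrC mul_mpolyC.
by rewrite mnm1E eq_sym (negPf ji) mulr0n.
Qed.

(** Factorials stay multiplied, never inverted, so that the duality below makes sense over any
    commutative ring. *)
Definition mfact n (x : 'X_{1..n}) : R := \prod_(j < n) (x j)`!%:R.

Lemma mfact0 n : mfact (0%MM : 'X_{1..n}) = 1.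
Proof. by apply: big1 => j _; rewrite mnmE. Qed.

Lemma mfactDU n (x : 'X_{1..n}) i :
  mfact (x + U_(i))%MM = mfact x *+ (x i).+1.
Proof.
rewrite /mfact !(bigD1 (P := predT) i) //= mnmDE mnm1E eqxx addn1 factS natrM.
rewrite -mulrA mulr_natl; congr (_ * _ *+ _).
by apply: eq_bigr => j ji; rewrite mnmDE mnm1E eq_sym (negPf ji) addn0.
Qed.

(* The derivative in X_i on the left and the product with X_i on the right give
   the same recursion in y. *)
Lemma lmonom_dual m n (M : 'M[R]_(m, n)) x y :
  mfact y * (lmonom M x)@_y = mfact x * (lmonom M^T y)@_x.
Proof.
elim/mnm_ind: y x => [|y i IH] x.
  rewrite mfact0 mul1r lmonom0 mcoeff1.
  have [->|x0] := eqVneq; first by rewrite lmonom0 mfact0 mcoeff1 eqxx mulr1.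
  have x0' : mdeg (0%MM : 'X_{1..m}) != mdeg x.
    by rewrite mdeg0 eq_sym mdeg_eq0.
  by rewrite mulr0 (dhomog_nemf_coeff (dhomog_lmonom M x)).
rewrite mfactDU mulrnAl -mulrnAr -mcoeff_deriv mderiv_lmonom.
rewrite raddf_sum mulr_sumr.
rewrite lmonomD lmonomU mulr_sumr raddf_sum mulr_sumr.
apply: eq_bigr => j _ /=; rewrite mcoeffMn mcoeffZ mxE -scalerAr mcoeffZ.
(* If [x j = 0], the left term has multiplicity 0 and the right one is a coefficient, free of X_j,
   of a multiple of X_j. Otherwise the multiplicity turns [mfact z] into [mfact x]. *)
have [xj|xj] := eqVneq (x j) 0%N.
  by rewrite xj mulr0n mcoeff_mulXU_eq0 // !mulr0.
have [z ->] : exists z, x = (z + U_(j))%MM.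
  by exists (x - U_(j))%MM; rewrite submK // lep1mP.
rewrite addmK mnmDE mnm1E eqxx addn1 mfactDU mulrnAr mulrCA IH.
by rewrite addmC mcoeffMX mulrnAl mulrCA.
Qed.

(** Substituting the forms of [A] for the variables of [lmonom B x] composes the two linear maps; by
    homogeneity only exponents of degree [N] occur. *)
Lemma lmonom_mul m n q (A : 'M[R]_(m, n)) (B : 'M[R]_(n, q)) x N :
  mdeg x = N ->
  lmonom (A *m B) x =
  \sum_(y : 'X_{1..n < N.+1} | mdeg y == N)
    (lmonom B x)@_y *: lmonom A y.
Proof.
move=> xN.
pose lq : n.-tuple {mpoly R[m]} :=
  [tuple \sum_(i < m) A i j *: 'X_i | j < n].
have lqE (j : 'I_n) : lq`_j = \sum_(i < m) A i j *: 'X_i.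
  by rewrite -tnth_nth tnth_mktuple.
have sz : (msize (lmonom B x) <= N.+1)%N.
  rewrite msizeE; apply/bigmax_leqP_seq => y yx _.
  by rewrite ltnS -xN (dhomog_mf (dhomog_lmonom B x) yx).
have -> : lmonom (A *m B) x = lmonom B x \mPo lq.
  rewrite [RHS]rmorph_prod; apply: eq_bigr => j _.
  rewrite rmorphXn; congr (_ ^+ _).
  rewrite raddf_sum /=.
  under [RHS]eq_bigr => l _ do rewrite comp_mpolyZ comp_mpolyXU lqE scaler_sumr.
  rewrite exchange_big /=; apply: eq_bigr => i _.
  by rewrite mxE scaler_suml; apply: eq_bigr => l _; rewrite scalerA mulrC.
rewrite (comp_mpolywE _ sz) [RHS]big_mkcond; apply: eq_bigr => y _.
case: eqP => [_|/eqP yx].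
  by congr (_ *: _); apply: eq_bigr => j _; rewrite tnth_mktuple.
by rewrite (dhomog_nemf_coeff (dhomog_lmonom B x)) ?xN ?scale0r.
Qed.

Lemma lmonom_mul_diag m n (M : 'M[R]_(m, n)) (d : 'rV[R]_n) x :
  lmonom (M *m diag_mx d) x = (\prod_(j < n) d 0 j ^+ x j) *: lmonom M x.
Proof.
rewrite -scaler_prod; apply: eq_bigr => j _; rewrite -exprZn; congr (_ ^+ _).
rewrite scaler_sumr; apply: eq_bigr => l _.
by rewrite mul_mx_diag mxE scalerA mulrC.
Qed.

Lemma lmonom_diag n (d : 'rV[R]_n) x :
  lmonom (diag_mx d) x = (\prod_(j < n) d 0 j ^+ x j) *: 'X_[x].
Proof.
rewrite -[diag_mx d]mul1mx lmonom_mul_diag; congr (_ *: _).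
rewrite mpolyXE_id; apply: eq_bigr => j _; congr (_ ^+ _).
rewrite (bigD1 j) //= big1 => [|l lj].
  by rewrite mxE eqxx scale1r addr0.
by rewrite mxE (negPf lj) scale0r.
Qed.

End LinearForms.

(** * Passage between n and n^+ *)

Section Multiindices.
Variables (N k : nat).

Lemma mdeg_mplus (n : 'X_{1..k}) : (mdeg n <= N)%N -> mdeg (mplus N n) = N.
Proof.
move=> nN; rewrite mdegE big_ord_recl mnmE unlift_none.
under eq_bigr do rewrite mnmE liftK.
by rewrite -mdegE subnK.
Qed.

Lemma mplusK : cancel (@mplus N k) (@mminus k).
Proof. by move=> n; apply/mnmP => j; rewrite !mnmE liftK. Qed.

Lemma mminusK (x : 'X_{1..k.+1}) : mdeg x = N -> mplus N (mminus x) = x.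
Proof.
move=> xN; apply/mnmP => i; rewrite mnmE.
case: unliftP => [j ->|->]; first by rewrite mnmE.
rewrite -xN !mdegE big_ord_recl; under [X in (_ - X)%N]eq_bigr do rewrite mnmE.
by rewrite addnK.
Qed.

Lemma mdeg_mminus (x : 'X_{1..k.+1}) : (mdeg (mminus x) <= mdeg x)%N.
Proof.
rewrite !mdegE big_ord_recl; under eq_bigr do rewrite mnmE.
exact: leq_addl.
Qed.

End Multiindices.

(** * Duality and orthogonality of Krawtchouk polynomials *)

Section Krawtchouk.
Variables (R : realType) (N k : nat).
Implicit Types (u v : 'I_k.+1 -> 'I_k.+1 -> R) (a b c p : 'I_k.+1 -> R).

(* The product on the right being homogeneous of degree N, no coefficient is
   lost by the substitution X_0 := 1. *)
Lemma krawtchouk_lmonom u (x : 'X_{1..k.+1}) (n : 'X_{1..k}) :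
  (forall j, u ord0 j = 1) -> mdeg x = N -> (mdeg n <= N)%N ->
  krawtchouk n x u = (lmonom (\matrix_(l, j) u l j) x)@_(mplus N n).
Proof.
move=> u0 xN nN; set P := lmonom _ _.
(* The substitution X_0 := 1, X_(l+1) := X_l. *)
pose lq : (k.+1).-tuple {mpoly R[k]} :=
  [tuple if unlift ord0 i is Some l then 'X_l else 1 | i < k.+1].
have lq0 : lq`_(ord0 : 'I_k.+1) = 1.
  by rewrite -tnth_nth tnth_mktuple unlift_none.
have lqS (l : 'I_k) : lq`_(lift ord0 l : 'I_k.+1) = 'X_l.
  by rewrite -tnth_nth tnth_mktuple liftK.
have sz : (msize P <= N.+1)%N.
  rewrite msizeE; apply/bigmax_leqP_seq => y yx _.
  by rewrite ltnS -xN (dhomog_mf (dhomog_lmonom _ _) yx).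
transitivity (P \mPo lq)@_n.
  congr (_@__); rewrite [RHS]rmorph_prod; apply: eq_bigr => j _.
  rewrite rmorphXn; congr (_ ^+ _); rewrite raddf_sum big_ord_recl /=.
  rewrite comp_mpolyZ comp_mpolyXU lq0 mxE u0 scale1r; congr (_ + _).
  by apply: eq_bigr => l _; rewrite comp_mpolyZ comp_mpolyXU lqS mxE.
rewrite (comp_mpolywE _ sz) raddf_sum /=.
have y0N : (mdeg (mplus N n) < N.+1)%N by rewrite mdeg_mplus.
have lqX (y : 'X_{1..k.+1}) :
    \prod_(i < k.+1) tnth lq i ^+ y i = 'X_[mminus y].
  rewrite big_ord_recl (tnth_nth 0) lq0 expr1n mul1r mpolyXE_id.
  by apply: eq_bigr => l _; rewrite (tnth_nth 0) lqS mnmE.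
(* Only [mplus N n] contributes: any other [y] has the wrong degree, hence coefficient 0, or is sent
   to a monomial other than X^n. *)
rewrite (bigD1 (BMultinom y0N)) //= [X in _ + X]big1 => [|y yn].
  by rewrite lqX mplusK mcoeffZ mcoeffX eqxx mulr1 addr0.
rewrite lqX mcoeffZ mcoeffX; have [yN|yN] := eqVneq (mdeg y) N; last first.
  by rewrite (dhomog_nemf_coeff (dhomog_lmonom _ _)) ?xN ?mul0r.
case: eqP => [ny|]; last by rewrite mulr0.
case/eqP: yn; apply/val_inj => /=.
by rewrite -ny mminusK.
Qed.

Lemma mfact_neq0 n (x : 'X_{1..n}) : mfact R x != 0.
Proof.
by apply/prodf_neq0 => j _; rewrite pnatr_eq0 -lt0n fact_gt0.
Qed.

Lemma krawtchouk_orthogonality b v c :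
  orthogonal_basis b v c -> krawtchouk_orthogonal N b v.
Proof.
move=> [v0 _ vc] x y xN yN xy.
pose V : 'M[R]_k.+1 := \matrix_(l, j) v l j.
pose X := mplus N x; pose Y := mplus N y.
have YX : Y != X by apply/eqP => /(can_inj (@mplusK N k)) /esym.
have VbV : V *m diag_mx (\row_j b j) *m V^T = diag_mx (\row_j c j).
  apply/matrixP => l m; rewrite mul_mx_diag !mxE -vc.
  by apply: eq_bigr => i _; rewrite !mxE mulrAC.
(* The weight supplies N! and 1/n!; transposing [X^Y] V^(n) into [X^n] (V^T)^(Y) absorbs 1/n! and
   leaves 1/Y!. *)
have -> : \sum_(n : 'X_{1..k.+1 < N.+1} | mdeg n == N)
    krawtchouk x n v * krawtchouk y n v * multinomial_pmf N n b
  = N`!%:R / mfact R Y * (lmonom (diag_mx (\row_j c j)) Y)@_X.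
  rewrite -VbV (lmonom_mul _ _ (mdeg_mplus yN)) raddf_sum mulr_sumr.
  apply: eq_bigr => n /eqP nN.
  rewrite !(krawtchouk_lmonom v0 nN) // -/V -/X -/Y.
  rewrite /multinomial_pmf /multinomial_coef -/(mfact R n).
  rewrite lmonom_mul_diag /= !mcoeffZ.
  under [in RHS]eq_bigr do rewrite mxE.
  have VT : (lmonom V^T Y)@_n = mfact R Y * (lmonom V n)@_Y / mfact R n.
    by rewrite lmonom_dual mulrAC divff ?mul1r ?mfact_neq0.
  rewrite VT; field.
  by rewrite !mfact_neq0.
(* A diagonal matrix yields a multiple of X^Y alone, and Y differs from X. *)
by rewrite lmonom_diag mcoeffZ mcoeffX (negPf YX) !mulr0.
Qed.

Lemma orthogonal_basis_dual p u a i j :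
  (forall j, 0 < p j) -> orthogonal_basis p u a ->
  \sum_(l < k.+1) (a l)^-1 * u l i * u l j = (p i)^-1 *+ (i == j).
Proof.
move=> p0 [_ a0 ua]; pose U : 'M[R]_k.+1 := \matrix_(l, j) u l j.
have : diag_mx (\row_l (a l)^-1) *m U *m (diag_mx (\row_j p j) *m U^T) = 1%:M.
  apply/matrixP => l m; rewrite -mulmxA mul_diag_mx mxE mulmxA mul_mx_diag !mxE.
  transitivity ((a l)^-1 * \sum_(i < k.+1) u l i * u m i * p i).
    congr (_ * _); apply: eq_bigr => n _.
    by rewrite !mxE mulrAC.
  rewrite ua; case: eqP => _; last by rewrite mulr0.
  by rewrite mulVf ?gt_eqF.
(* A one-sided inverse of a square matrix is two-sided, so diag(p) U^T diag(a)^-1 U = 1 as well. *)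
move/mulmx1C/matrixP/(_ i j); rewrite -mulmxA mul_diag_mx mul_diag_mx !mxE.
move=> pE; have pi0 : p i != 0 by rewrite gt_eqF.
apply: (mulfI pi0); rewrite [RHS]mulrnAr divff // -pE; congr (_ * _).
by apply: eq_bigr => l _; rewrite !mxE mulrCA mulrA.
Qed.

Lemma krawtchouk_duality u (x : 'X_{1..k.+1}) (n : 'X_{1..k}) :
  (forall j, u ord0 j = 1) -> (forall i, omega u ord0 i != 0) ->
  mdeg x = N -> (mdeg n <= N)%N ->
  (multinomial_coef R N (mplus N n))^-1 * multinomial_coef R N x
    * krawtchouk n x u
  = \prod_(i < k.+1) omega u ord0 i ^+ mplus N n i
    * krawtchouk (mminus x) (mplus N n) (omega_hat u).
Proof.
move=> u0 w0 xN nN.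
have h0 j : omega_hat u ord0 j = 1 by rewrite /omega_hat divff.
rewrite (krawtchouk_lmonom u0 xN nN) (krawtchouk_lmonom h0 (mdeg_mplus nN));
  last by rewrite -xN mdeg_mminus.
rewrite mminusK //; set U := \matrix_(l, j) u l j; set V := \matrix_(l, j) _.
(* Normalising by omega^(0) rescales columns; these scalars become the product of powers in front of
   Q*. *)
have UV : U^T = V *m diag_mx (\row_i omega u ord0 i).
  by apply/matrixP => l j; rewrite mul_mx_diag !mxE divfK.
have := lmonom_dual U x (mplus N n); rewrite UV lmonom_mul_diag mcoeffZ.
under [X in _ = _ * (X * _)]eq_bigr do rewrite mxE.
rewrite /multinomial_coef -!/(mfact R _) => dual.
(* N! cancels between the two multinomial coefficients, leaving the ratio n^+!/x! of the
   transposition identity. *)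
apply: (mulfI (mfact_neq0 x)); rewrite -dual; field.
by rewrite !mfact_neq0 pnatr_eq0 -lt0n fact_gt0.
Qed.

End Krawtchouk.

Theorem theorem3 (R : realType) (N k : nat) (hN : (1 <= N)%N)
    (hd : (2 <= k.+1)%N)
    (p : 'I_k.+1 -> R) (hp : distribution p) (hp0 : forall j, 0 < p j)
    (u : 'I_k.+1 -> 'I_k.+1 -> R) (a : 'I_k.+1 -> R)
    (hu : orthogonal_basis p u a)
    (homega : forall i, omega u ord0 i != 0) :
  [/\ forall (x : 'X_{1..k.+1}) (n : 'X_{1..k}),
        mdeg x = N -> (mdeg n <= N)%N ->
        (multinomial_coef R N (mplus N n))^-1 * multinomial_coef R N x
          * krawtchouk n x u
        = \prod_(i < k.+1) omega u ord0 i ^+ mplus N n i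
          * krawtchouk (mminus x) (mplus N n) (omega_hat u),
      distribution (dual_dist u a),
      exists c : 'I_k.+1 -> R,
        orthogonal_basis (dual_dist u a) (omega_hat u) c
    & krawtchouk_orthogonal N (dual_dist u a) (omega_hat u)].
Proof.
have [u0 a0 _] := hu.
have w_gt0 l : 0 < (a l)^-1 * omega u ord0 l ^+ 2.
  by rewrite mulr_gt0 ?invr_gt0 // exprn_even_gt0 /=.
pose W := \sum_(l < k.+1) (a l)^-1 * omega u ord0 l ^+ 2.
have W_gt0 : 0 < W.
  by rewrite /W big_ord_recl ltr_pwDl // sumr_ge0 // => l _; apply: ltW.
(* In the dual weights the factor omega^(0) squared cancels the denominators of two omega-hats, so
   the inverted relation, divided by [W], gives these squared norms. *)
pose c l := W^-1 * (p l)^-1.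
have hc : orthogonal_basis (dual_dist u a) (omega_hat u) c.
  split=> [j|l|l m].
  - by rewrite /omega_hat divff.
  - by rewrite mulr_gt0 ?invr_gt0.
  rewrite -mulrnAr -(orthogonal_basis_dual l m hp0 hu) mulr_sumr.
  apply: eq_bigr => i _; rewrite /dual_dist /proportional_dist -/W.
  rewrite /omega_hat; move: (homega i); rewrite /omega => ui0.
  by field; rewrite ui0 !gt_eqF.
split.
- by move=> x n; apply: krawtchouk_duality.
- split=> [j|]; first by rewrite divr_ge0 ?ltW.
  by rewrite -mulr_suml divff ?gt_eqF.
- by exists c.
- exact: krawtchouk_orthogonality hc.
Qed.
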